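(* Let $f:[0,1]\to\mathbb R$ be of class $C^1$ with $f(0)=f(1)=0$, $f>0$ in $(0,1)$ and $f'(0)=0$. Let $u_0:\mathbb R\to[0,1]$ be uniformly continuous with $u_0>0$ in $\mathbb R$, $\liminf_{x\to-\infty}u_0(x)>0$ and $\lim_{x\to+\infty}u_0(x)=0$. Let $u(t,x)$ be the solution of $\partial_t u=\partial_{xx}u+f(u)$ for $t>0$, $x\in\mathbb R$, with initial condition $u(0,\cdot)=u_0$, and let $E_\lambda(t)$, $\gamma$, $t_\lambda$ be as defined in the context. Let $\beta>1$ be arbitrary. Assume that for all $\alpha>0$ there are $C_\alpha>0$ and $x_0^\alpha>1$ such that $$u_0(x)\leq\frac{C_\alpha}{x^\alpha},\quad \forall x\geq x_0^\alpha .$$ Assume that there are $r>0$, $\delta>0$ and $s_0\in(0,1)$ such that $$f(s)\leq r s^\beta(1-s^\delta),\quad \forall\, 0\leq s\leq s_0.$$ Then there is a speed $c>0$ such that, for any $\lambda\in(0,1)$, there is a time $T_\lambda\geq t_\lambda$ such that $$\emptyset\neq E_\lambda(t)\subset(\gamma t,ct),\quad \forall t\geq T_\lambda.$$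
   Context: For $\lambda\in(0,1)$ and $t\geq 0$, $E_\lambda(t):=\{x\in\mathbb R:\ u(t,x)=\lambda\}$ denotes the $\lambda$-level set of $u(t,\cdot)$. Under the stated assumptions on $f$ and $u_0$ one has $0<u(t,x)<1$ for all $t>0$, $x\in\mathbb R$; there is $\gamma>0$ such that $\lim_{t\to\infty}\inf_{x\leq\gamma t}u(t,x)=1$; and $\lim_{x\to+\infty}u(t,x)=0$ for every $t\geq0$. Such a $\gamma>0$ is fixed. Consequently, for any $\lambda\in(0,1)$ there is a time $t_\lambda>0$, which is fixed, such that $\emptyset\neq E_\lambda(t)\subset(\gamma t,+\infty)$ for all $t\geq t_\lambda$. *)

(* Defs.v *)
From HB Require Import structures.
From mathcomp Require Import all_boot all_order all_algebra.
From mathcomp Require Import all_classical all_reals all_analysis.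

Set Implicit Arguments.
Unset Strict Implicit.
Unset Printing Implicit Defensive.

Import Order.TTheory GRing.Theory Num.Theory.
Import numFieldNormedType.Exports.

Local Open Scope classical_set_scope.
Local Open Scope ring_scope.

(* A function on [0, 1] is represented by a total function on R whose values
   off [0, 1] are junk; its derivative at x only sees increments inside A,
   hence is one-sided at the end points when A is a segment. *)
Definition is_derive_within (R : realType) (A : set R) (f : R -> R) (x l : R)
    : Prop :=
  (f y - f x) / (y - x) @[y --> within A x^'] --> l.

Definition C1_on (R : realType) (A : set R) (f : R -> R) : Prop :=
  exists g : R -> R,
    (forall x : R, A x -> is_derive_within A f x (g x)) /\
    {within A, continuous g}.

(* Classical solution (t first, x second) of u_t = u_xx + f(u) on t > 0 with
   u(0, .) = u0. The values u t x with t < 0 are junk, which is why continuity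
   up to t = 0 is relative to the half space t >= 0. The bound 0 <= u <= 1 is
   needed for f(u) to make sense, f being given on [0, 1] only. *)
Record is_solution (R : realType) (f u0 : R -> R) (u : R -> R -> R) : Prop :=
  IsSolution {
    sol_range : forall t x : R, 0 <= t -> 0 <= u t x <= 1;
    sol_init : forall x : R, u 0 x = u0 x;
    sol_cont : {within [set p : R * R | 0 <= p.1],
                 continuous (fun p : R * R => u p.1 p.2)};
    sol_derivable_t : forall t x : R, 0 < t -> derivable (u ^~ x) t 1;
    sol_derivable_x : forall t x : R, 0 < t -> derivable (u t) x 1;
    sol_derivable_xx : forall t x : R, 0 < t -> derivable (derive1 (u t)) x 1;
    sol_cont_t : {within [set p : R * R | 0 < p.1],
                   continuous (fun p : R * R => derive1 (u ^~ p.2) p.1)};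
    sol_cont_x : {within [set p : R * R | 0 < p.1],
                   continuous (fun p : R * R => derive1 (u p.1) p.2)};
    sol_cont_xx : {within [set p : R * R | 0 < p.1],
                    continuous (fun p : R * R => derive1n 2 (u p.1) p.2)};
    sol_eq : forall t x : R, 0 < t ->
      derive1 (u ^~ x) t = derive1n 2 (u t) x + f (u t x) }.

Definition level_set (R : realType) (u : R -> R -> R) (lambda t : R) : set R :=
  [set x | u t x = lambda].

(* Main.v *)
Require Import Defs.
From HB Require Import structures.
From mathcomp Require Import all_boot all_order all_algebra.
From mathcomp Require Import all_classical all_reals all_analysis.
From mathcomp Require Import ring lra.

Set Implicit Arguments.
Unset Strict Implicit.
Unset Printing Implicit Defensive.

Import Order.TTheory GRing.Theory Num.Theory.
Import numFieldNormedType.Exports.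

Local Open Scope classical_set_scope.
Local Open Scope ring_scope.

(** Because u0 decays faster than every power, the weak Allee effect
    f(s) <= r s^beta can be beaten by one travelling supersolution with an
    algebraic tail. Choose a natural number p with p (beta - 1) >= 1 and try
    phi(x - c t), where phi(z) = (L / z)^p. With y = L / z <= 1,
      - c phi' = (c p / L) y^(p+1),     phi'' = O(y^(p+2)),
      f(phi) <= r y^(p beta) <= r y^(p+1),
    so the transport term controls both diffusion and reaction once c is of
    order L. The decay of u0 at the single rate p provides an L such that
    phi >= u0 on [L, +oo[, and phi = 1 >= u at z = L. The comparison principle
    then gives u(t, x) <= (L / (x - c t))^p for x >= c t + L
    ([solution_le_algebraic_front]). This upper bound carries one speed c for
    all levels: if x >= (c + 1) t then u(t, x) <= L / t, which is smaller than
    any given lambda for t large. The remaining assertions on the level sets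
    are those assumed for t >= t_lambda.

    The comparison is made on an unbounded half-line moving with speed c.
    Compactness is recovered by adding eps e^(M t) (1 + x) to phi: the sum
    exceeds 1 >= u beyond some X, and it is a strict supersolution wherever it
    is at most 1, because (y^p + b)^beta <= y^(p+1) + 2 b there
    ([powR_pow_add_le]). Strictness lets the contradiction be read off at the
    first contact point, where the two functions take the same value, so that
    f enters through its upper bound only, without any Lipschitz estimate
    ([strict_maximum_principle]). Finally eps tends to 0. *)

(** * A strict parabolic maximum principle *)

(** Were g'' (x) > 0, then g' would be positive just to the right of the
    critical point x, and the mean value theorem would make g exceed g x. *)
Lemma second_derivative_le0_at_max (R : realType) (g : R -> R) (a b x d : R) :
  x \in `]a, b[ ->
  (forall y : R, y \in `]a, b[ -> derivable g y 1) ->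
  (forall y : R, y \in `]a, b[ -> g y <= g x) ->
  is_derive x 1 (derive1 g) d -> d <= 0.
Proof.
move=> xab dg gx [dg' <-].
have ab : a <= b by move: xab; rewrite in_itv /=; lra.
have g'x : derive1 g x = 0.
  by rewrite derive1E; have [_ ->] := derive1_at_max ab dg xab gx.
rewrite leNgt; apply/negP => d_gt0.
have cvg_q : h^-1 *: (derive1 g (h + x) - derive1 g x) @[h --> 0^'] -->
    'D_1 (derive1 g) x.
  move: dg'; rewrite /derivable /derive /=.
  under eq_fun do rewrite [_ *: 1]mulr1.
  by [].
have [e e0 he] := cvgr_gt _ cvg_q _ d_gt0; have {e0} e_gt0 : (0 : R) < e := e0.
have [m xm] : exists m, x < m /\ m < b /\ m < x + e.
  have /andP[ax xb] : a < x < b by move: xab; rewrite in_itv.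
  case: (leP (x + e / 2) ((x + b) / 2)) => ?;
    by [exists (x + e / 2); lra | exists ((x + b) / 2); lra].
have dm y : y \in `]x, m[ -> is_derive y 1 g (derive1 g y).
  rewrite in_itv /= => ym; rewrite derive1E; apply: derivableP; apply: dg.
  by move: xab; rewrite !in_itv /=; lra.
have [||z zm gz] := @MVT _ g (derive1 g) x m _ dm.
- by lra.
- apply: derivable_within_continuous => y; rewrite in_itv /= => ym; apply: dg.
  by move: xab; rewrite !in_itv /=; lra.
have : g m <= g x by apply: gx; move: xab; rewrite !in_itv /=; lra.
suff : 0 < derive1 g z.
  move=> g'z; have : 0 < derive1 g z * (m - x) by apply: mulr_gt0 => //; lra.
  by lra.
have /= := he (z - x).
rewrite in_itv /= in zm.
rewrite sub0r normrN subrK g'x subr0 ger0_norm; last by lra.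
move=> /(_ ltac:(lra)) /(_ ltac:(rewrite subr_eq0; lra)).
by rewrite [_ *: _]mulrC pmulr_lgt0 // invr_gt0; lra.
Qed.

(** The set where v >= 0 is compact, so the time coordinate has a minimum on
    it. *)
Lemma first_nonneg_time (R : realType) (v : R -> R -> R) (T a b t0 x0 : R) :
  {within `[0, T] `*` `[a, b], continuous (fun p : R * R => v p.1 p.2)} ->
  t0 \in `[0, T] -> x0 \in `[a, b] -> 0 <= v t0 x0 ->
  exists t x : R, [/\ t \in `[0, T], x \in `[a, b], 0 <= v t x &
    forall s y : R, 0 <= s -> s < t -> y \in `[a, b] -> v s y < 0].
Proof.
move=> vc t0T x0ab v0.
set A := `[0, T] `*` `[a, b] in vc.
have cA : compact A by apply: compact_setX; exact: segment_compact.
pose S : set (R * R) := A `&` [set p | 0 <= v p.1 p.2].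
have cS : compact S.
  apply: (subclosed_compact _ cA); last by move=> ? [].
  have : closed ((fun p : R * R => v p.1 p.2) @^-1` [set x | 0 <= x]
      : set (subspace A)).
    by apply: preimage_closed; [move=> ? _; exact: vc | exact: closed_ge].
  move=> /closed_subspaceP [V cV VA].
  rewrite /S setIC (_ : _ `&` _ = V `&` A) //; apply: closedI => //.
  exact: (compact_closed _ cA).
have [|||[t x] tS tmin] := @compact_EVT_min _ R fst S.
- by exists (t0, x0); split.
- exact: cS.
- by apply: continuous_subspaceT => p; exact: cvg_fst.
move: tS; rewrite inE => -[[/= tT xab] vtx]; exists t, x; split => // s y s0 st yab.
rewrite ltNge; apply/negP => vsy.
have : (s, y) \in S.
  rewrite inE; split => //; split => //=; rewrite in_itv /=.
  by move: tT; rewrite in_itv /=; lra.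
by move=> /tmin /=; rewrite leNgt st.
Qed.

(** At the first time t when v reaches 0, at x say, v(t, .) <= 0 has an interior
    maximum at x and v(., x) increases to 0, so v_xx <= 0 <= v_t, against
    v_t < v_xx. The differential inequality and the smoothness are required
    only near zeros of v: this accommodates nonlinear reactions, which cancel
    where two functions agree, and barriers with corners. *)
Lemma strict_maximum_principle (R : realType) (v : R -> R -> R) (T a b : R) :
  {within `[0, T] `*` `[a, b], continuous (fun p : R * R => v p.1 p.2)} ->
  (forall x : R, x \in `[a, b] -> v 0 x < 0) ->
  (forall t : R, t \in `[0, T] -> v t a < 0 /\ v t b < 0) ->
  (forall t x : R, t \in `]0, T] -> x \in `]a, b[ -> v t x = 0 ->
    exists vt vxx : R, [/\ is_derive t 1 (v ^~ x) vt,
      \forall y \near x, derivable (v t) y 1,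
      is_derive x 1 (derive1 (v t)) vxx & vt < vxx]) ->
  forall t x : R, t \in `[0, T] -> x \in `[a, b] -> v t x < 0.
Proof.
move=> vc v0 vab zero t0 x0 t0T x0ab; rewrite ltNge; apply/negP => v0_ge0.
have [t [x [tT xab vtx_ge0 before]]] := first_nonneg_time vc t0T x0ab v0_ge0.
have t_neq0 : t != 0.
  by apply/negP => /eqP t_0; move: vtx_ge0; rewrite t_0 leNgt v0.
have t_gt0 : 0 < t by rewrite lt_def t_neq0; move: tT; rewrite in_itv /=; lra.
(* Negativity before t passes to the limit: v(t, .) <= 0. *)
have vt_le0 y : y \in `[a, b] -> v t y <= 0.
  move=> yab.
  have cvg_vy : v s y @[s --> t^'-] --> v t y.
    have /subspace_continuousP /(_ (t, y)) /(_ (conj tT yab)) vty := vc.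
    have sy : (s, y) @[s --> t^'-] --> within (`[0, T] `*` `[a, b]) (nbhs (t, y)).
      have sy : (s, y) @[s --> t^'-] --> (t, y).
        apply: (@cvg_pair _ _ _ (at_left t) (nbhs t) (nbhs y)) => //=; last exact: cvg_cst.
        by apply: cvg_at_left_filter; exact: cvg_id.
      move=> U UA; suff : \forall s \near t^'-, U (s, y) by [].
      near=> s.
      have : (`[0, T] `*` `[a, b]) (s, y) -> U (s, y).
        by near: s; exact: (sy _ UA).
      apply; split => //=; rewrite in_itv /=; apply/andP; split.
        by near: s; exact: nbhs_left_ge.
      have : s < t by near: s; exact: nbhs_left_lt.
      by move: tT; rewrite in_itv /=; lra.
    exact: (cvg_comp _ _ sy vty).
  rewrite -(cvg_lim _ cvg_vy) //; apply: limr_le; first by apply/cvg_ex; exists (v t y).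
  near=> s; apply/ltW; apply: before yab.
    by near: s; exact: nbhs_left_ge.
  by near: s; exact: nbhs_left_lt.
have vtx : v t x = 0 by apply/eqP; rewrite eq_le vtx_ge0 vt_le0.
have x_itv : x \in `]a, b[.
  have [va vb] := vab _ tT; move: xab; rewrite !in_itv /= => /andP[ax xb].
  apply/andP; split; rewrite lt_def ?ax ?xb andbT; apply/negP => /eqP xE.
  - by move: va; rewrite -xE vtx ltxx.
  - by move: vb; rewrite xE vtx ltxx.
have [vt [vxx [dvt dvx dvxx]]] : _ := zero t x ltac:(rewrite in_itv /= t_gt0; move: tT; rewrite in_itv /=; lra) x_itv vtx.
apply/negP; rewrite -leNgt.
(* The hypothesis on derivability holds in a ball around x only. *)
have vxx_le0 : vxx <= 0.
  have [e e0 he] := dvx; have {e0} e_gt0 : (0 : R) < e := e0.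
  pose a' := Num.max a (x - e); pose b' := Num.min b (x + e).
  have sub y : y \in `]a', b'[ -> [/\ a < y, y < b, x - e < y & y < x + e].
    by rewrite in_itv /= gt_max lt_min => /andP[/andP[-> ->] /andP[-> ->]].
  apply: (@second_derivative_le0_at_max _ (v t) a' b' x) => //.
  - rewrite in_itv /= gt_max lt_min; move: x_itv; rewrite in_itv /=; lra.
  - by move=> y /sub[*]; apply: he; rewrite /ball /= ltr_norml; lra.
  - by move=> y /sub[*]; rewrite vtx; apply: vt_le0; rewrite in_itv /=; lra.
(* v_t >= 0 comes from difference quotients on the left of t, where v < 0. *)
apply: (le_trans vxx_le0).
case: dvt => dvt <-.
have cvg_q : h^-1 *: (v (h + t) x - v t x) @[h --> 0^'-] --> 'D_1 (v ^~ x) t.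
  apply: cvg_dnbhs_at_left; move: dvt; rewrite /derivable /derive /=.
  under eq_fun do rewrite [_ *: 1]mulr1.
  by [].
rewrite -(cvg_lim _ cvg_q) //; apply: limr_ge; first by apply/cvg_ex; eexists; exact: cvg_q.
near=> h.
have h_lt0 : h < 0 by near: h; exact: nbhs_left_lt.
have h_gt : - t <= h by near: h; apply: nbhs_left_ge; lra.
rewrite vtx subr0; apply: mulr_le0; first by rewrite invr_le0 ltW.
by apply/ltW/before => //; lra.
Unshelve. all: by end_near.
Qed.

(** * The reaction term below an algebraic profile *)

(** Powers of L / h are stable under differentiation up to a constant, which
    keeps all derivatives of the profile monomials in y = L / z. *)
Lemma is_derive_pow_divr (R : realType) (L x dh : R) (h : R -> R) (n : nat) :
  is_derive x 1 h dh -> L != 0 -> h x != 0 ->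
  is_derive x 1 (fun y => (L / h y) ^+ n)
    (- (n%:R / L) * (L / h x) ^+ n.+1 * dh).
Proof.
move=> dhx L0 hx0.
have dV : is_derive x 1 (fun y => (h y)^-1) (- (h x) ^- 2 *: dh) by exact: is_deriveV.
have dL : is_derive x 1 (fun y => L / h y) (L *: (- (h x) ^- 2 *: dh)).
  exact: is_deriveZ.
have -> : (fun y => (L / h y) ^+ n) = (fun y => L / h y) ^+ n.
  by apply/funext => y; rewrite exprfctE.
apply: is_derive_eq.
rewrite ![_ *: _]mulrC.
case: n => [|n]; first by rewrite /= !mul0r oppr0 !mul0r mulr0.
rewrite /= expr2 !exprS; move: (_ ^+ n) (n.+1%:R) => Y N.
by field; rewrite hx0.
Qed.

(** For s = y^p + b <= 1 the condition on p gives s^beta <= s q, where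
    q = s^(1/p) lies in [y, 1]. Moving from y to q costs at most
    y^p (q - y) <= q^p - y^p = b, and b q <= b. This takes the place of
    linearizing s^beta at y^p. *)
Lemma powR_pow_add_le (R : realType) (y b beta : R) (p : nat) :
  0 <= y -> 0 <= b -> y ^+ p + b <= 1 -> 1 <= p%:R * (beta - 1) ->
  (y ^+ p + b) `^ beta <= y ^+ p.+1 + 2 * b.
Proof.
move=> y0 b0 s1 pbeta.
have p_gt0 : (0 < p)%N.
  by case: p pbeta {s1} => //; rewrite mul0r leNgt ltr01.
have pR : 0 < p%:R :> R by rewrite ltr0n.
set s := y ^+ p + b in s1 *.
have yp0 : 0 <= y ^+ p by exact: exprn_ge0.
have s0 : 0 <= s by rewrite addr_ge0.
have [s_eq0|s_neq0] := eqVneq s 0.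
  rewrite s_eq0 powR0; last first.
    by apply/eqP => beta0; move: pbeta; rewrite beta0; nra.
  by rewrite addr_ge0 ?exprn_ge0 ?mulr_ge0.
have s_gt0 : 0 < s by rewrite lt_def s_neq0.
pose q := s `^ p%:R^-1.
have q0 : 0 <= q by exact: powR_ge0.
have qp : q ^+ p = s.
  by rewrite -powR_mulrn // -powRrM mulVf ?powRr1 // gt_eqF.
have q1 : q <= 1.
  by rewrite -(@ler_pXn2r _ p) ?nnegrE // expr1n qp.
have yq : y <= q by rewrite -(@ler_pXn2r _ p) ?nnegrE // qp /s lerDl.
have sq : s `^ beta <= s * q.
  rewrite -[X in X * q]powRr1 // /q -powRD; last by rewrite s_neq0 implybT.
  apply: ger_powR; first by rewrite s_gt0.
  rewrite -lerBrDl -(ler_pM2l pR) mulfV // gt_eqF //.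
apply: (le_trans sq).
suff : y ^+ p * q <= y ^+ p.+1 + b.
  rewrite /s mulrDl => yq'.
  have : b * q <= b by rewrite ler_piMr.
  lra.
have -> : b = q ^+ p - y ^+ p by rewrite qp /s addrC addKr.
have y1 : y <= 1 by exact: le_trans q1.
have ypq : y ^+ p.-1 * q <= q ^+ p.
  rewrite -{2}(prednK p_gt0) exprSr ler_wpM2r //.
  by apply: lerXn2r; rewrite ?nnegrE.
have ypE : y ^+ p = y ^+ p.-1 * y by rewrite -exprSr prednK.
have yp'0 : 0 <= y ^+ p.-1 by exact: exprn_ge0.
rewrite exprSr -lerBlDl -mulrBr.
apply: (@le_trans _ _ (y ^+ p.-1 * (q - y))).
  by rewrite ler_wpM2r ?subr_ge0 // ypE ler_piMr.
by rewrite mulrBr -ypE lerD2r.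
Qed.

(** A bounded difference quotient forces f y - f x to 0; the point y = x, which
    the punctured filter omits, is harmless. *)
Lemma C1_on_continuous (R : realType) (A : set R) (f : R -> R) :
  C1_on A f -> {within A, continuous f}.
Proof.
move=> [g [dg _]]; apply/subspace_continuousP => x Ax.
have df := dg x Ax; rewrite /is_derive_within in df.
have dx : y - x @[y --> within A x^'] --> x - x.
  apply: cvgB; last exact: cvg_cst.
  apply: cvg_trans (cvg_within _) _; exact: nbhs_dnbhs.
have fx : f y @[y --> within A x^'] --> f x.
  have : (f y - f x) / (y - x) * (y - x) + f x @[y --> within A x^'] -->
      g x * (x - x) + f x.
    by apply: cvgD; [apply: cvgM | exact: cvg_cst].
  rewrite subrr mulr0 add0r; apply: cvg_trans; apply: near_eq_cvg.
  near=> y.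
  have yx : y != x by near: y; apply: (@cvg_within _ (x^') _ A [set y | y != x]); exact: withinT.
  by rewrite /= divfK ?subrK // subr_eq0.
move=> U Ux.
have near_x : \forall y \near x, y != x -> A y -> U (f y) := fx U Ux.
suff : \forall y \near x, A y -> U (f y) by [].
apply: filterS near_x => y yU Ay.
by have [->|yx] := eqVneq y x; [exact: nbhs_singleton | exact: yU].
Unshelve. all: by end_near.
Qed.

(** Away from 0 the power s^beta is bounded below, so enlarging the constant
    absorbs the maximum of f there. *)
Lemma le_powR_of_le_near0 (R : realType) (f : R -> R) (beta r delta s0 : R) :
  {within `[0, 1], continuous f} -> 0 <= beta ->
  0 < r -> 0 < s0 ->
  (forall s : R, 0 <= s <= s0 -> f s <= r * s `^ beta * (1 - s `^ delta)) ->
  exists2 r', 0 < r' & forall s : R, 0 <= s <= 1 -> f s <= r' * s `^ beta.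
Proof.
move=> fc beta0 r0 s0_gt0 fle.
have [m _ fm] := EVT_max ler01 fc.
have s0b : 0 < s0 `^ beta by exact: powR_gt0.
exists (r + `|f m| / s0 `^ beta).
  by rewrite ltr_pwDl // divr_ge0 // ltW.
move=> s /andP[s_ge0 s1]; rewrite mulrDl.
have sb := powR_ge0 s beta.
have m0 : 0 <= `|f m| / s0 `^ beta by rewrite divr_ge0 // ltW.
have [ss0|s0s] := leP s s0.
  apply: le_trans (fle s _) _; first by rewrite s_ge0.
  apply: (@le_trans _ _ (r * s `^ beta)); last by rewrite lerDl mulr_ge0.
  by rewrite ler_piMr ?mulr_ge0 ?(ltW r0) // gerBl powR_ge0.
have fs : f s <= `|f m|.
  by apply: le_trans (ler_norm _); apply: fm; rewrite in_itv /= s_ge0.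
apply: (le_trans fs); rewrite ler_wpDl ?mulr_ge0 ?(ltW r0) //.
rewrite -[leLHS](@divfK _ (s0 `^ beta)) ?gt_eqF // ler_wpM2l //.
by apply: ge0_ler_powR => //; rewrite ?nnegrE // ltW.
Qed.

(** * The barrier *)

(** The maximum freezes the profile at the value 1 behind the front
    x - c t = L. The barrier is thus continuous on the whole plane and can be
    compared with u on a fixed rectangle, although the front moves. The last
    term makes it large as x tends to +oo. *)
Definition barrier (R : realType) (L c eps M : R) (p : nat) (t x : R) : R :=
  (L / Num.max (x - c * t) L) ^+ p + eps * expR (M * t) * (1 + x).

Lemma continuous_barrier (R : realType) (L c eps M : R) (p : nat) : 0 < L ->
  continuous (fun q : R * R => barrier L c eps M p q.1 q.2).
Proof.
move=> L0 q.
have cz : z.2 - c * z.1 @[z --> q] --> q.2 - c * q.1.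
  apply: cvgB; first exact: cvg_snd.
  by apply: cvgM; [exact: cvg_cst | exact: cvg_fst].
have cM : M * z.1 @[z --> q] --> M * q.1.
  by apply: cvgM; [exact: cvg_cst | exact: cvg_fst].
have cm : Num.max (z.2 - c * z.1) L @[z --> q] --> Num.max (q.2 - c * q.1) L.
  by apply: (continuous_max cz); exact: cvg_cst.
apply: cvgD; last first.
  apply: cvgM; last by apply: cvgD; [exact: cvg_cst | exact: cvg_snd].
  apply: cvgM; first exact: cvg_cst.
  by apply: (cvg_comp _ _ cM); exact: continuous_expR.
have cV : L / Num.max (z.2 - c * z.1) L @[z --> q] -->
    L / Num.max (q.2 - c * q.1) L.
  apply: cvgM; first exact: cvg_cst.
  by apply: cvgV => //; rewrite gt_eqF // lt_max L0 orbT.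
by apply: (cvg_comp _ (fun y => y ^+ p) cV); exact: exprn_continuous.
Qed.

Lemma barrierE (R : realType) (L c eps M t x : R) (p : nat) :
  L <= x - c * t ->
  barrier L c eps M p t x =
    (L / (x - c * t)) ^+ p + eps * expR (M * t) * (1 + x).
Proof. by move=> Lz; rewrite /barrier max_l. Qed.

Lemma barrier_gt1 (R : realType) (L c eps M t x : R) (p : nat) :
  0 < L -> x - c * t <= L -> 0 < eps -> 0 <= x -> 1 < barrier L c eps M p t x.
Proof.
move=> L0 zL eps0 x0; rewrite /barrier max_r // divff ?gt_eqF // expr1n.
by rewrite ltrDl !mulr_gt0 ?expR_gt0 //; lra.
Qed.

Lemma is_derive_barrier_t (R : realType) (L c eps M t x : R) (p : nat) :
  0 < L -> L < x - c * t ->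
  is_derive t 1 (fun s => barrier L c eps M p s x)
    (c * p%:R / L * (L / (x - c * t)) ^+ p.+1 +
     M * (eps * expR (M * t) * (1 + x))).
Proof.
move=> L0 Lz.
have near_t : \forall s \near t, L < x - c * s.
  have : x - c * s @[s --> t] --> x - c * t.
    apply: cvgB; first exact: cvg_cst.
    by apply: cvgM; [exact: cvg_cst | exact: cvg_id].
  by move=> /cvgr_gt; apply.
apply: (@near_eq_is_derive _ _ _
  (fun s => (L / (x - c * s)) ^+ p + eps * expR (M * s) * (1 + x))).
  by near=> s; rewrite barrierE // ltW //; near: s.
have dz : is_derive t 1 (fun s => x - c * s) (- c).
  by apply: is_derive_eq; rewrite /GRing.scale /=; ring.
have z0 : x - c * t != 0 by rewrite gt_eqF // (lt_trans L0).
have dY := is_derive_pow_divr p dz (lt0r_neq0 L0) z0.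
have dM : is_derive t 1 (fun s => M * s) M.
  by apply: is_derive_eq; rewrite /GRing.scale /=; ring.
have dE : is_derive t 1 (fun s => expR (M * s)) (expR (M * t) * M).
  exact: (is_derive1_comp (is_derive_expR _) dM).
apply: is_derive_eq; rewrite /GRing.scale /=; field; lra.
Unshelve. all: by end_near.
Qed.

Lemma is_derive_barrier_x (R : realType) (L c eps M t x : R) (p : nat) :
  0 < L -> L < x - c * t ->
  is_derive x 1 (barrier L c eps M p t)
    (- (p%:R / L) * (L / (x - c * t)) ^+ p.+1 + eps * expR (M * t)).
Proof.
move=> L0 Lz.
have near_x : \forall y \near x, L < y - c * t.
  have : y - c * t @[y --> x] --> x - c * t.
    by apply: cvgB; [exact: cvg_id | exact: cvg_cst].
  by move=> /cvgr_gt; apply.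
apply: (@near_eq_is_derive _ _ _
  (fun y => (L / (y - c * t)) ^+ p + eps * expR (M * t) * (1 + y))).
  by near=> y; rewrite barrierE // ltW //; near: y.
have dz : is_derive x 1 (fun y => y - c * t) 1.
  by apply: is_derive_eq; rewrite /GRing.scale /=; ring.
have z0 : x - c * t != 0 by rewrite gt_eqF // (lt_trans L0).
have dY := is_derive_pow_divr p dz (lt0r_neq0 L0) z0.
by apply: is_derive_eq; rewrite /GRing.scale /=; ring.
Unshelve. all: by end_near.
Qed.

Lemma is_derive_barrier_xx (R : realType) (L c eps M t x : R) (p : nat) :
  0 < L -> L < x - c * t ->
  is_derive x 1 (derive1 (barrier L c eps M p t))
    (p%:R * p.+1%:R / L ^+ 2 * (L / (x - c * t)) ^+ p.+2).
Proof.
move=> L0 Lz.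
have near_x : \forall y \near x, L < y - c * t.
  have : y - c * t @[y --> x] --> x - c * t.
    by apply: cvgB; [exact: cvg_id | exact: cvg_cst].
  by move=> /cvgr_gt; apply.
apply: (@near_eq_is_derive _ _ _ (fun y =>
  - (p%:R / L) * (L / (y - c * t)) ^+ p.+1 + eps * expR (M * t))).
  near=> y; rewrite derive1E.
  have Ly : L < y - c * t by near: y.
  by have [_ ->] := is_derive_barrier_x eps M p L0 Ly.
have dz : is_derive x 1 (fun y => y - c * t) 1.
  by apply: is_derive_eq; rewrite /GRing.scale /=; ring.
have z0 : x - c * t != 0 by rewrite gt_eqF // (lt_trans L0).
have dY := is_derive_pow_divr p.+1 dz (lt0r_neq0 L0) z0.
by apply: is_derive_eq; rewrite /GRing.scale /=; field; lra.
Unshelve. all: by end_near.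
Qed.

(** * Comparison with the solution *)

(** The value of c makes c p / L = p (p + 1) + p r: the first part dominates the
    diffusion of the profile, the second the reaction. *)
Lemma solution_le_algebraic_front (R : realType) (f u0 : R -> R)
    (u : R -> R -> R) (r beta L : R) (p : nat) :
  is_solution f u0 u ->
  0 < r -> (forall s : R, 0 <= s <= 1 -> f s <= r * s `^ beta) ->
  1 <= p%:R * (beta - 1) ->
  1 <= L -> (forall x : R, L <= x -> u0 x <= (L / x) ^+ p) ->
  let c := L * (p%:R + 1 + r) in
  forall t x : R, 0 <= t -> L <= x - c * t ->
    u t x <= (L / (x - c * t)) ^+ p.
Proof.
move=> u_sol r0 fle pbeta L1 u0le c t0 x0 t0_ge0 Lz0.
have L_gt0 : 0 < L by lra.
have p_ge1 : 1 <= p%:R :> R.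
  case: p pbeta {u0le c Lz0} => [|p _]; last by rewrite ler1n.
  by rewrite mul0r leNgt ltr01.
have c_gt0 : 0 < c by apply: mulr_gt0 => //; lra.
have x0_ge0 : 0 <= x0 by have := mulr_ge0 (ltW c_gt0) t0_ge0; lra.
have u1 s y : 0 <= s -> u s y <= 1 by move=> /(sol_range u_sol y)/andP[].
apply/ler_addgt0Pr => e e0.
(* 2 r pays for the reaction on the additional term b in powR_pow_add_le;
   the extra 1 makes the supersolution strict. *)
pose M := 2 * r + 1.
pose K := expR (M * t0) * (1 + x0).
have K0 : 0 < K by apply: mulr_gt0; [exact: expR_gt0 | lra].
(* At the point (t0, x0) the additional term of the barrier is exactly e. *)
pose eps := e / K.
have eps0 : 0 < eps by exact: divr_gt0.
have -> : (L / (x0 - c * t0)) ^+ p + e = barrier L c eps M p t0 x0.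
  by rewrite barrierE // -mulrA divfK // gt_eqF.
(* At x = X the additional term alone exceeds 1. *)
have [X x0X epsX] : exists2 X, x0 <= X & 1 <= eps * X.
  exists (x0 + eps^-1); first by rewrite lerDl invr_ge0 ltW.
  by rewrite mulrDr mulfV ?gt_eqF // lerDr mulr_ge0 // ltW.
have X0 : 0 <= X by exact: le_trans x0X.
pose v t x := u t x - barrier L c eps M p t x.
(* Contact with the barrier can only occur ahead of the front. *)
have behind s y : 0 <= s -> 0 <= y -> y - c * s <= L -> v s y < 0.
  move=> s0 y0 zL; rewrite /v subr_lt0; apply: (le_lt_trans (u1 s y s0)).
  exact: barrier_gt1.
suff : v t0 x0 < 0 by rewrite /v subr_lt0 => /ltW.
apply: (@strict_maximum_principle _ v t0 0 X); last 2 first.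
- by rewrite in_itv /= t0_ge0 lexx.
- by rewrite in_itv /= x0_ge0.
- have uc : {within `[0, t0] `*` `[0, X],
      continuous (fun q : R * R => u q.1 q.2)}.
    apply: continuous_subspaceW (sol_cont u_sol) => -[s y] [/= + _].
    by rewrite in_itv /= => /andP[].
  have bc : {within `[0, t0] `*` `[0, X],
      continuous (fun q : R * R => barrier L c eps M p q.1 q.2)}.
    by apply: continuous_subspaceT; exact: continuous_barrier.
  by move=> q; apply: cvgB; [exact: uc | exact: bc].
- move=> y; rewrite in_itv /= => /andP[y0 _].
  have [yL|Ly] := leP (y - c * 0) L; first exact: behind.
  rewrite /v subr_lt0 barrierE ?(ltW Ly) // (sol_init u_sol).
  rewrite mulr0 subr0 in Ly *.
  apply: (le_lt_trans (u0le _ (ltW Ly))).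
  by rewrite ltrDl; apply: mulr_gt0; [apply: mulr_gt0 => //; exact: expR_gt0 | lra].
- move=> s; rewrite in_itv /= => /andP[s0 _]; split.
    by apply: behind => //; have := mulr_ge0 (ltW c_gt0) s0; lra.
  rewrite /v subr_lt0; apply: (le_lt_trans (u1 s X s0)).
  have E1 : 1 <= expR (M * s).
    by rewrite -expR0 ler_expR mulr_ge0 //; rewrite /M; lra.
  have Y0 : 0 <= (L / Num.max (X - c * s) L) ^+ p.
    by rewrite exprn_ge0 // divr_ge0 ?le_max ?(ltW L_gt0) ?orbT.
  rewrite /barrier.
  have : eps * (1 + X) <= eps * expR (M * s) * (1 + X).
    by rewrite -mulrA ler_pM2l // ler_peMl //; lra.
  by rewrite mulrDr mulr1; lra.
(* At a contact point the equation for u contradicts strictness. *)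
move=> s y; rewrite !in_itv /= => /andP[s0 st0] /andP[y0 yX] vsy.
have Lz : L < y - c * s.
  by rewrite ltNge; apply/negP => /(behind _ _ (ltW s0) (ltW y0)); rewrite vsy ltxx.
pose z := y - c * s; pose Y := L / z; pose b := eps * expR (M * s) * (1 + y).
have z0 : 0 < z by rewrite /z; lra.
have b0 : 0 < b.
  by apply: mulr_gt0; [apply: mulr_gt0 => //; exact: expR_gt0 | lra].
have Y0 : 0 <= Y by rewrite divr_ge0 // ltW.
have Y1 : Y <= 1 by rewrite ler_pdivrMr // mul1r ltW.
have uE : u s y = Y ^+ p + b.
  by apply/eqP; rewrite -subr_eq0 -barrierE ?(ltW Lz) //; apply/eqP.
have fu : f (u s y) <= r * (Y ^+ p.+1 + 2 * b).
  apply: le_trans (fle _ (sol_range u_sol y (ltW s0))) _.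
  rewrite ler_pM2l // uE; apply: powR_pow_add_le => //; first exact: ltW.
  by rewrite -uE u1 // ltW.
have u_x w : derivable (u s) w 1 by exact: (sol_derivable_x u_sol).
have near_y : \forall w \near y, L < w - c * s.
  have : w - c * s @[w --> y] --> y - c * s.
    by apply: cvgB; [exact: cvg_id | exact: cvg_cst].
  by move=> /cvgr_gt; apply.
exists (derive1 (u ^~ y) s -
    (c * p%:R / L * Y ^+ p.+1 + M * b)),
  (derive1n 2 (u s) y - p%:R * p.+1%:R / L ^+ 2 * Y ^+ p.+2); split.
- apply: is_deriveB; last exact: is_derive_barrier_t.
  by rewrite derive1E; apply: derivableP; exact: (sol_derivable_t u_sol).
- near=> w.
  have Lw : L < w - c * s by near: w.
  have [db _] := is_derive_barrier_x eps M p L_gt0 Lw.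
  exact: derivableB.
- apply: (@near_eq_is_derive _ _ _
      (fun w => derive1 (u s) w - derive1 (barrier L c eps M p s) w)).
    near=> w.
    have Lw : L < w - c * s by near: w.
    have [db _] := is_derive_barrier_x eps M p L_gt0 Lw.
    by rewrite !derive1E deriveB.
  apply: is_deriveB; last exact: is_derive_barrier_xx.
  rewrite /= derive1E; apply: derivableP; exact: (sol_derivable_xx u_sol).
- rewrite (sol_eq u_sol) //.
  have cE : c * p%:R / L = p%:R * p.+1%:R + p%:R * r.
    by rewrite /c -natr1; field; rewrite gt_eqF.
  set P : R := p%:R in p_ge1 cE *; set Q := Y ^+ p.+1 in fu *.
  have Q0 : 0 <= Q by exact: exprn_ge0.
  have PS : 0 <= P * p.+1%:R by apply: mulr_ge0 => //; lra.
  have : P * p.+1%:R / L ^+ 2 * Y ^+ p.+2 <= P * p.+1%:R * Q.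
    rewrite [Y ^+ _]exprSr -/Q mulrA -[leRHS]mulr1.
    apply: ler_pM => //.
    + by rewrite mulr_ge0 // divr_ge0 // exprn_ge0 // ltW.
    + apply: ler_wpM2r => //; rewrite ler_pdivrMr ?exprn_gt0 //.
      by rewrite ler_peMr // exprn_ege1.
  have : r * Q <= P * r * Q by rewrite ler_wpM2r // ler_peMl // ltW.
  rewrite cE mulrDl /M.
  move: (derive1n 2 _ _) (P * p.+1%:R * Q) (P * p.+1%:R / _ * _) => A B C.
  by nra.
Unshelve. all: by end_near.
Qed.

Theorem corollary2p4 (R : realType) (f u0 : R -> R) (u : R -> R -> R)
    (gamma : R) (t_ : R -> R) (beta : R)
    (f_C1 : C1_on `[0, 1] f)
    (f_0 : f 0 = 0) (f_1 : f 1 = 0)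
    (f_gt0 : forall s : R, 0 < s < 1 -> 0 < f s)
    (f'_0 : is_derive_within `[0, 1] f 0 0)
    (u0_range : forall x : R, 0 <= u0 x <= 1)
    (u0_unif : unif_continuous u0)
    (u0_gt0 : forall x : R, 0 < u0 x)
    (u0_liminf : (0 < limf_einf (fun x => (u0 x)%:E) -oo%R)%E)
    (u0_lim : u0 x @[x --> +oo] --> 0)
    (u_sol : is_solution f u0 u)
    (gamma_gt0 : 0 < gamma)
    (gamma_lim :
      inf [set u t x | x in [set x | x <= gamma * t]] @[t --> +oo] --> (1 : R))
    (t_P : forall lambda : R, 0 < lambda < 1 ->
      0 < t_ lambda /\
      forall t : R, t_ lambda <= t ->
        level_set u lambda t !=set0 /\
        level_set u lambda t `<=` `]gamma * t, +oo[)
    (beta_gt1 : 1 < beta)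
    (u0_light : forall alpha : R, 0 < alpha ->
      exists C x0 : R, 0 < C /\ 1 < x0 /\
        forall x : R, x0 <= x -> u0 x <= C / x `^ alpha)
    (f_Allee : exists r delta s0 : R,
      0 < r /\ 0 < delta /\ 0 < s0 < 1 /\
      forall s : R, 0 <= s <= s0 -> f s <= r * s `^ beta * (1 - s `^ delta)) :
  exists c : R, 0 < c /\
    forall lambda : R, 0 < lambda < 1 ->
      exists T : R, t_ lambda <= T /\
        forall t : R, T <= t ->
          level_set u lambda t !=set0 /\
          level_set u lambda t `<=` `]gamma * t, c * t[.
Proof.
have [r1 [delta [s0 [r1_gt0 [_ [/andP[s0_gt0 _] f_le]]]]]] := f_Allee.
have beta_ge0 : 0 <= beta by lra.
have [r r_gt0 f_le_r] := le_powR_of_le_near0 (C1_on_continuous f_C1) beta_ge0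
  r1_gt0 s0_gt0 f_le.
have [p p_gt0 pbeta] : exists2 p, (0 < p)%N & 1 <= p%:R * (beta - 1).
  exists (Num.truncn (beta - 1)^-1).+1 => //.
  rewrite -ler_pdivrMr; last by lra.
  by rewrite mul1r ltW // truncnS_gt.
have [C [x0 [C_gt0 [x0_gt1 u0_le]]]] := u0_light p%:R ltac:(by rewrite ltr0n).
have [L x0L CL] : exists2 L, x0 <= L & C <= L.
  by exists (x0 + C); lra.
have L1 : 1 <= L by lra.
have u0_leL x : L <= x -> u0 x <= (L / x) ^+ p.
  move=> Lx; have x_gt0 : 0 < x by lra.
  apply: le_trans (u0_le x ltac:(lra)) _.
  rewrite powR_mulrn ?(ltW x_gt0) // expr_div_n ler_pM2r ?invr_gt0 ?exprn_gt0 //.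
  by apply: (le_trans CL); exact: ler_eXnr.
pose c := L * (p%:R + 1 + r).
have c_gt0 : 0 < c by apply: mulr_gt0; [|have := ler0n R p]; lra.
exists (c + 1); split; first by lra.
move=> lambda lambda01; have /andP[l_gt0 l_lt1] := lambda01.
have [_ t_lev] := t_P lambda lambda01.
have Ll : L <= L / lambda by rewrite ler_pdivlMr // ler_piMr //; lra.
exists (Num.max (t_ lambda) (L / lambda + 1)); split.
  by rewrite le_max lexx.
move=> t; rewrite ge_max => /andP[tl tL].
have [ne lev] := t_lev t tl; split=> // x xl.
have := lev x xl; rewrite /= !in_itv /= andbT => -> /=.
rewrite ltNge; apply/negP => cx.
(* Travelling at speed c + 1 puts x at distance at least t ahead of the front. *)
have zt : t <= x - c * t by lra.
have := solution_le_algebraic_front u_sol r_gt0 f_le_r pbeta L1 u0_leL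
  (ltac:(lra) : 0 <= t) (ltac:(rewrite -/c; lra) : L <= x - c * t).
rewrite [u t x]xl -/c leNgt => /negP; apply.
have z_gt0 : 0 < x - c * t by lra.
apply: (@le_lt_trans _ _ (L / (x - c * t))).
  apply: ler_iXnr => //; first by rewrite divr_ge0 //; lra.
  by rewrite ler_pdivrMr // mul1r; lra.
rewrite ltr_pdivrMr // mulrC -ltr_pdivrMr //; lra.
Qed.
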